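(* Let $\eta>0$, $\lambda>0$ with $\eta\lambda\le \tfrac12$, let $x(0)\in\mathbb{R}^d\setminus\{0\}$, and let $(x(t))_{t\ge0}$ be the GD+WD iterates $x(t+1)=(1-\eta\lambda)x(t)-\eta\nabla L(x(t))$. Set $$T_0=\left\lceil \frac{1}{2\eta\lambda}\left(\left|\ln \frac{\|x(0)\|_2^2}{\rho\pi^2\eta}\right|+3\right)\right\rceil .$$ Then $$\min_{t=0,\ldots,T_0}\|\nabla L(\bar x(t))\|_2^2\le 8\pi^4\rho^2\lambda\eta .$$
   Context: $L:\mathbb{R}^d\setminus\{0\}\to\mathbb{R}$ is $C^2$ and scale invariant, i.e. $L(cx)=L(x)$ for all $c>0$ and $x\neq0$. $\rho:=\max_{\|x\|_2=1}\|\nabla^2L(x)\|_2$ (spectral norm), assumed $\rho>0$. For $x\ne0$, $\bar x:=x/\|x\|_2$. (For scale invariant $L$ one has $\langle\nabla L(x),x\rangle=0$, so the iterates remain nonzero when $\eta\lambda<1$.) *)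

(* Defs.v *)
From HB Require Import structures.
From mathcomp Require Import all_boot all_order all_algebra.
From mathcomp Require Import all_classical all_reals all_analysis.
Set Implicit Arguments. Unset Strict Implicit. Unset Printing Implicit Defensive.
Import Order.TTheory GRing.Theory Num.Theory.
Import numFieldNormedType.Exports.
Local Open Scope classical_set_scope.
Local Open Scope ring_scope.

Section Defs.
Variables (R : realType) (d : nat).

Definition norm2 (v : 'rV[R]_d) : R := Num.sqrt (\sum_i v ord0 i ^+ 2).

Definition normalize (v : 'rV[R]_d) : 'rV[R]_d := (norm2 v)^-1 *: v.

Definition ebase (i : 'I_d) : 'rV[R]_d := delta_mx ord0 i.

Definition grad (L : 'rV[R]_d -> R) (x : 'rV[R]_d) : 'rV[R]_d :=
  \row_i ('d L x (ebase i)).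

Definition hess (L : 'rV[R]_d -> R) (x : 'rV[R]_d) : 'M[R]_d :=
  \matrix_(i, j) ('d (grad L) x (ebase i)) ord0 j.

Definition C2_off0 (L : 'rV[R]_d -> R) : Prop :=
  forall x : 'rV[R]_d, x != 0 ->
    [/\ differentiable L x, differentiable (grad L) x & {for x, continuous (hess L)}].

Definition scale_invariant (L : 'rV[R]_d -> R) : Prop :=
  forall (c : R) (x : 'rV[R]_d), 0 < c -> x != 0 -> L (c *: x) = L x.

Definition specnorm (M : 'M[R]_d) : R :=
  sup [set norm2 (v *m M^T) | v in [set v : 'rV[R]_d | norm2 v = 1]].

(* rho = max_{||x||_2 = 1} ||hess L x||_2 (written as a sup; the max is attained) *)
Definition rho (L : 'rV[R]_d -> R) : R :=
  sup [set specnorm (hess L x) | x in [set x : 'rV[R]_d | norm2 x = 1]].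

End Defs.

Definition T0 (R : realType) (rho0 eta lam n0 : R) : nat :=
  `| Num.ceil ((2 * eta * lam)^-1 *
               (`| ln (n0 ^+ 2 / (rho0 * pi ^+ 2 * eta)) | + 3)) |%N.

(* Main.v *)
Require Import Defs.
From HB Require Import structures.
From mathcomp Require Import all_boot all_order all_algebra.
From mathcomp Require Import all_classical all_reals all_analysis.
From mathcomp Require Import ring lra.
Set Implicit Arguments. Unset Strict Implicit. Unset Printing Implicit Defensive.
Import Order.TTheory GRing.Theory Num.Theory.
Import numFieldNormedType.Exports.
Local Open Scope classical_set_scope.
Local Open Scope ring_scope.

(** By homogeneity the gradient is orthogonal to [x] and the Hessian at [x] is at
    most [rho / |x|^2], so [n = |x|^2] and [G = |grad L (normalize x)|^2] satisfy
    [n' = (1 - u)^2 n + eta^2 G / n] with [u = eta * lam], while [L] decreases by about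
    [eta G / n] per step as soon as [n >> rho * eta].  Suppose [G] stays above the
    threshold.  A norm below [a = rho * pi^2 * eta] grows by a factor [e^(2u)] per
    step until it exceeds [a]; from then on [n] decays at rate [e^(-2u)] up to
    [2 * eta] times the decrease of [L], hence becomes [O(a)] because [L] oscillates by at
    most [2 * pi * rho].  The last [1 / u] steps then decrease [L] by more than
    this oscillation. *)

(** * The Euclidean inner product and the spectral norm *)

Section DotProduct.
Context {R : realType} {d : nat}.
Implicit Types u v w : 'rV[R]_d.

Definition dot u v : R := \sum_i u ord0 i * v ord0 i.

Lemma dotC u v : dot u v = dot v u.
Proof. by apply: eq_bigr => i _; rewrite mulrC. Qed.

Lemma dotDl u v w : dot (u + v) w = dot u w + dot v w.
Proof.
by rewrite /dot -big_split; apply: eq_bigr => i _; rewrite /= mxE mulrDl.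
Qed.

Lemma dotZl c u v : dot (c *: u) v = c * dot u v.
Proof. by rewrite /dot mulr_sumr; apply: eq_bigr => i _; rewrite mxE mulrA. Qed.

Lemma dotDr u v w : dot u (v + w) = dot u v + dot u w.
Proof. by rewrite dotC dotDl !(dotC u). Qed.

Lemma dotZr c u v : dot u (c *: v) = c * dot u v.
Proof. by rewrite dotC dotZl (dotC u). Qed.

Lemma dotNl u v : dot (- u) v = - dot u v.
Proof. by rewrite -scaleN1r dotZl mulN1r. Qed.

Lemma dotNr u v : dot u (- v) = - dot u v.
Proof. by rewrite dotC dotNl (dotC u). Qed.

Definition dotE := (dotDl, dotDr, dotNl, dotNr, dotZl, dotZr).

Lemma dot_ge0 u : 0 <= dot u u.
Proof. by apply: sumr_ge0 => i _; rewrite -expr2 sqr_ge0. Qed.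

Lemma dot_eq0 u : (dot u u == 0) = (u == 0).
Proof.
apply/idP/eqP => [|->]; last by rewrite /dot big1 // => i _; rewrite mxE mul0r.
rewrite psumr_eq0; last by move=> i _; rewrite -expr2 sqr_ge0.
move=> /allP u0; apply/rowP => i; rewrite mxE.
by have := u0 i (mem_index_enum i); rewrite /= mulf_eq0 orbb => /eqP.
Qed.

Lemma dot_gt0 u : (0 < dot u u) = (u != 0).
Proof. by rewrite lt_def dot_ge0 dot_eq0 andbT. Qed.

Lemma norm2_sqr u : norm2 u ^+ 2 = dot u u.
Proof.
rewrite /norm2 sqr_sqrtr; last by apply: sumr_ge0 => i _; rewrite sqr_ge0.
by apply: eq_bigr => i _; rewrite expr2.
Qed.

Lemma norm2_ge0 u : 0 <= norm2 u.
Proof. exact: sqrtr_ge0. Qed.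

Lemma norm2_eq1 u : dot u u = 1 -> norm2 u = 1.
Proof.
move=> u1; apply/eqP; rewrite -(eqrXn2 (n := 2)) ?norm2_ge0 //.
by rewrite norm2_sqr u1 expr1n.
Qed.

Lemma norm2_gt0 u : u != 0 -> 0 < norm2 u.
Proof.
move=> u0; rewrite lt_def norm2_ge0 andbT; apply: contraNneq u0 => u0.
by rewrite -dot_eq0 -norm2_sqr u0 expr0n.
Qed.

Lemma dot_normalize u : u != 0 -> dot (normalize u) (normalize u) = 1.
Proof.
move=> u0; have := norm2_gt0 u0 => n0.
by rewrite /normalize !dotE -norm2_sqr; field; rewrite gt_eqF.
Qed.

Lemma normalize_neq0 u : u != 0 -> normalize u != 0.
Proof. by move=> u0; rewrite -dot_gt0 dot_normalize. Qed.

Lemma CauchySchwarz_dot u v : dot u v ^+ 2 <= dot u u * dot v v.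
Proof.
have [->|v0] := eqVneq v 0.
  by rewrite -(scale0r 0) !dotE !mul0r !mulr0 expr0n.
have v_gt0 : 0 < dot v v by rewrite dot_gt0.
(* This vector is [dot v v] times the part of [u] orthogonal to [v]; its squared norm is [dot v v]
   times the gap in the inequality. *)
have := dot_ge0 (dot v v *: u - dot u v *: v).
rewrite !dotE (dotC v u) => h.
rewrite -subr_ge0 -(pmulr_rge0 _ v_gt0).
by apply: le_trans h _; rewrite le_eqVlt; apply/orP; left; apply/eqP; ring.
Qed.

(** By Pythagoras, moving orthogonally to [u] never brings the point closer to the origin, where
    nothing is known about [L]. *)
Lemma perp_line_neq0 u v s : u != 0 -> dot u v = 0 -> u + s *: v != 0.
Proof.
rewrite -!dot_gt0 => u0 uv; rewrite !dotE (dotC v) uv !mulr0 addr0 add0r.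
by rewrite mulrA -expr2 (lt_le_trans u0) // lerDl mulr_ge0 ?sqr_ge0 ?dot_ge0.
Qed.

(* Bounding the defining supremum by the Frobenius norm: without a bound, [sup] would be [0]. *)
Lemma norm2_le_specnorm (M : 'M[R]_d) u :
  norm2 u = 1 -> norm2 (u *m M^T) <= specnorm M.
Proof.
move=> u1; apply: (ub_le_sup _ (ex_intro2 _ _ u u1 erefl)).
(* The summand [1] turns a bound on the square into one on the norm: [y ^+ 2 <= F] gives
   [y <= 1 + F]. *)
exists (1 + \sum_j dot (row j M) (row j M)) => _ [v /= v1 <-].
have v1' : dot v v = 1 by rewrite -norm2_sqr v1 expr1n.
set F := \sum_j _.
have F0 : 0 <= F by apply: sumr_ge0 => j _; exact: dot_ge0.
suff : norm2 (v *m M^T) ^+ 2 <= F.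
  have := norm2_ge0 (v *m M^T); nra.
rewrite norm2_sqr; apply: ler_sum => j _.
have -> : (v *m M^T) ord0 j = dot (row j M) v.
  by rewrite mxE; apply: eq_bigr => k _; rewrite !mxE mulrC.
by rewrite -expr2 (le_trans (CauchySchwarz_dot _ _)) // v1' mulr1.
Qed.

(** A matrix and its transpose have the same quadratic form, so Cauchy-Schwarz reduces the bound to
    [v *m M^T] with [v] a unit vector. *)
Lemma quadratic_form_le_specnorm (M : 'M[R]_d) u :
  `|dot (u *m M) u| <= specnorm M * dot u u.
Proof.
have [->|u0] := eqVneq u 0.
  by rewrite -(scale0r 0) !dotE !mul0r mulr0 normr0.
have n0 := norm2_gt0 u0.
have [v v1 uE] : exists2 v, dot v v = 1 & u = norm2 u *: v.
  exists (normalize u); first exact: dot_normalize.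
  by rewrite scalerA divff ?scale1r ?gt_eqF.
have -> : dot (u *m M) u = dot u u * dot v (v *m M^T).
  rewrite -norm2_sqr {1 2}uE -scalemxAl !dotE mulrA -expr2; congr (_ * _).
  rewrite /dot; transitivity (\sum_i \sum_j v ord0 j * M j i * v ord0 i).
      by apply: eq_bigr => i _; rewrite mxE mulr_suml.
  rewrite exchange_big; apply: eq_bigr => i _; rewrite /= mxE mulr_sumr.
  by apply: eq_bigr => j _; rewrite mxE; ring.
rewrite normrM ger0_norm ?dot_ge0 // mulrC ler_wpM2r ?dot_ge0 //.
apply: le_trans (norm2_le_specnorm M (norm2_eq1 v1)).
rewrite -ler_sqr ?nnegrE ?norm2_ge0 // real_normK ?num_real // norm2_sqr.
by rewrite (le_trans (CauchySchwarz_dot _ _)) // v1 mul1r.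
Qed.

End DotProduct.

(** * Monotonicity and derivatives along lines *)

Lemma le_of_derive_le0 {R : realType} (f df : R -> R) (a b : R) : a <= b ->
  (forall s, a <= s <= b -> is_derive s 1 f (df s)) ->
  (forall s, a <= s <= b -> df s <= 0) -> f b <= f a.
Proof.
move=> ab fd df0.
(* The mean value theorem stands in for integration: later integral estimates become monotonicity of
   a function minus its comparison function. *)
have [s sab||c cab fE] := @MVT_segment R f df a b ab.
- by apply: fd; move: sab; rewrite in_itv => /andP[/ltW -> /ltW ->].
- apply: derivable_within_continuous => s; rewrite in_itv /= => /fd fs.
  exact: ex_derive.
rewrite -subr_le0 fE mulr_le0_ge0 ?subr_ge0 //.
by apply: df0; move: cab; rewrite in_itv.
Qed.

Section LineDerivatives.
Context {R : realType} {d : nat}.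
Implicit Types (L : 'rV[R]_d -> R) (x v w : 'rV[R]_d).

Lemma is_derive_line (W : normedModType R) (f : 'rV[R]_d -> W) x v (s : R) :
  differentiable f (x + s *: v) ->
  is_derive s 1 (fun h : R => f (x + h *: v)) ('d f (x + s *: v) v).
Proof.
move=> fd.
have lined : is_diff s (fun h : R => x + h *: v) ( *:%R ^~ v).
  by apply: (is_diff_eq (is_diffD (is_diff_cst x s) (is_diff_scalel s v))); rewrite add0r.
have := @is_diff_comp _ _ _ _ _ _ _ _ _ lined (differentiableP fd).
move=> [fld fle]; apply: DeriveDef; first exact/diff_derivable.
by rewrite deriveE // fle /= scale1r.
Qed.

Lemma diff_dot_grad L x v : 'd L x v = dot (grad L x) v.
Proof.
rewrite [in LHS](row_sum_delta v) linear_sum; apply: eq_bigr => i _.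
by rewrite linearZ mxE mulrC.
Qed.

Lemma diff_grad_hess L x v : 'd (grad L) x v = v *m hess L x.
Proof.
apply/rowP => j; rewrite {1}(row_sum_delta v) linear_sum summxE mxE.
by apply: eq_bigr => i _; rewrite linearZ !mxE.
Qed.

Lemma is_derive_L_line L x v (s : R) : differentiable L (x + s *: v) ->
  is_derive s 1 (fun h : R => L (x + h *: v)) (dot (grad L (x + s *: v)) v).
Proof. by rewrite -diff_dot_grad; exact: is_derive_line. Qed.

Lemma is_derive_grad_line L x v w (s : R) :
  differentiable (grad L) (x + s *: v) ->
  is_derive s 1 (fun h : R => dot (grad L (x + h *: v)) w)
    (dot (v *m hess L (x + s *: v)) w).
Proof.
move=> gd; have [gl] := is_derive_line gd.
rewrite derive_mx // diff_grad_hess => ge.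
have gi i : is_derive s 1 (fun h : R => w ord0 i *: grad L (x + h *: v) ord0 i)
    (w ord0 i *: (v *m hess L (x + s *: v)) ord0 i).
  apply: is_deriveZ; apply: DeriveDef.
    by move/derivable_mxP : gl; apply.
  by rewrite -ge mxE.
have := is_derive_sum gi; rewrite /dot.
have -> : (\sum_(i < d) (fun h : R => w ord0 i *: grad L (x + h *: v) ord0 i)) =
   (fun h : R => \sum_i grad L (x + h *: v) ord0 i * w ord0 i).
  by apply/funext => h; rewrite fct_sumE; apply: eq_bigr => i _; rewrite mulrC.
by move=> /is_derive_eq; apply; apply: eq_bigr => i _; rewrite mulrC.
Qed.

(** The complement of the origin is open. Scaling identities therefore hold near [s = 0], which is
    all that a derivative at [0] sees. *)
Lemma near_line_neq0 x v : x != 0 -> \forall s \near (0 : R), x + s *: v != 0.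
Proof.
move=> x0.
have cont : (fun s : R => x + s *: v) @ (0 : R) --> x + 0 *: v.
  by apply: cvgD; [exact: cvg_cst | exact: scalel_continuous].
apply: (cont [set y | y != 0]); rewrite scale0r addr0.
have /closed_openC op : closed [set 0 : 'rV[R]_d].
  exact/accessible_closed_set1/hausdorff_accessible/norm_hausdorff.
apply: (@filterS _ _ _ (~` [set 0])); first by move=> y /eqP.
by apply: open_nbhs_nbhs; split=> //; apply/eqP.
Qed.

End LineDerivatives.

(** Testing with [v] equal to the difference of the two sides makes its squared norm vanish. *)
Lemma dot_scale_inj {R : realType} {d : nat} (c : R) (u w : 'rV[R]_d) :
  c != 0 -> (forall v, dot u (c *: v) = dot w v) -> u = c^-1 *: w.
Proof.
move=> c0 uw; apply/eqP; rewrite -subr_eq0 -dot_eq0; apply/eqP.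
have [z zE] : exists z, z = u - c^-1 *: w by eexists.
by rewrite -zE {1}zE dotDl dotNl dotZl -uw dotZr mulKf ?subrr.
Qed.

Lemma near_eq_is_derive_unique {R : realType} (f g : R -> R) (a df dg : R) :
  (\near a, f a = g a) -> is_derive a 1 f df -> is_derive a 1 g dg -> df = dg.
Proof.
by move=> fg /(near_eq_is_derive fg) [_ <-] [_ <-].
Qed.

(** * Gradient, Hessian, oscillation and descent of a scale invariant function *)

Section ScaleInvariant.
Context {R : realType} {d : nat} (L : 'rV[R]_d -> R).
Hypotheses (LC2 : C2_off0 L) (LS : scale_invariant L) (rho_gt0 : 0 < rho L).
Implicit Types (x y p q v w : 'rV[R]_d).

Let diffL x : x != 0 -> differentiable L x.
Proof. by case/LC2. Qed.

Let diffgrad x : x != 0 -> differentiable (grad L) x.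
Proof. by case/LC2. Qed.

Let derL x v (s : R) : x + s *: v != 0 ->
  is_derive s 1 (fun h : R => L (x + h *: v)) (dot (grad L (x + s *: v)) v).
Proof. by move=> /diffL; exact: is_derive_L_line. Qed.

Let dergrad x v w (s : R) : x + s *: v != 0 ->
  is_derive s 1 (fun h : R => dot (grad L (x + h *: v)) w)
    (dot (v *m hess L (x + s *: v)) w).
Proof. by move=> /diffgrad; exact: is_derive_grad_line. Qed.

(** Euler's relation: [x + s *: x] stays on the ray of [x] for [s > -1], and [L] is constant
    there. *)
Lemma grad_perp x : x != 0 -> dot (grad L x) x = 0.
Proof.
move=> x0; have : x + 0 *: x != 0 by rewrite scale0r addr0.
move=> /derL; rewrite scale0r addr0 => dL.
apply: (near_eq_is_derive_unique _ dL (is_derive_cst (L x) _ _)); near=> s.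
have -> : x + s *: x = (1 + s) *: x by rewrite scalerDl scale1r.
rewrite LS //.
near: s; apply: (@filterS _ _ _ [set s : R | - 1 < s]).
  by move=> s /=; lra.
by apply: lt_nbhsr; rewrite oppr_lt0 ltr01.
Unshelve. all: by end_near. Qed.

(** Scaling base point and direction together leaves [L] unchanged along the whole line, hence also
    its slope. *)
Let scaled_dot_grad (c : R) x v : 0 < c -> x != 0 ->
  dot (grad L (c *: x)) (c *: v) = dot (grad L x) v.
Proof.
move=> c0 x0.
have cx0 : c *: x != 0 by rewrite scaler_eq0 negb_or gt_eqF.
have : c *: x + 0 *: (c *: v) != 0 by rewrite scale0r addr0.
move=> /derL; rewrite scale0r addr0 => dLc.
have : x + 0 *: v != 0 by rewrite scale0r addr0.
move=> /derL; rewrite scale0r addr0 => dL.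
apply: (near_eq_is_derive_unique _ dLc dL); near=> s.
have -> : c *: x + s *: (c *: v) = c *: (x + s *: v).
  by rewrite scalerDr !scalerA mulrC.
rewrite LS //.
by near: s; exact: near_line_neq0.
Unshelve. all: by end_near. Qed.

Lemma grad_scale (c : R) x : 0 < c -> x != 0 ->
  grad L (c *: x) = c^-1 *: grad L x.
Proof.
move=> c0 x0; apply: dot_scale_inj => [|v]; first by rewrite gt_eqF.
exact: scaled_dot_grad.
Qed.

(** Obtained by differentiating [scaled_dot_grad] once more along the line: the Hessian is
    homogeneous of degree -2. *)
Let hess_quad_scale (c : R) x v : 0 < c -> x != 0 ->
  c ^+ 2 * dot (v *m hess L (c *: x)) v = dot (v *m hess L x) v.
Proof.
move=> c0 x0.
have cx0 : c *: x != 0 by rewrite scaler_eq0 negb_or gt_eqF.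
have : c *: x + 0 *: (c *: v) != 0 by rewrite scale0r addr0.
move=> /(dergrad (c *: v)); rewrite scale0r addr0 => dLc.
have : x + 0 *: v != 0 by rewrite scale0r addr0.
move=> /(dergrad v); rewrite scale0r addr0 => dL.
have -> : c ^+ 2 * dot (v *m hess L (c *: x)) v =
          dot (c *: v *m hess L (c *: x)) (c *: v).
  by rewrite -scalemxAl !dotE; ring.
apply: (near_eq_is_derive_unique _ dLc dL); near=> s.
have -> : c *: x + s *: (c *: v) = c *: (x + s *: v).
  by rewrite scalerDr !scalerA mulrC.
apply: scaled_dot_grad => //.
by near: s; exact: near_line_neq0.
Unshelve. all: by end_near. Qed.

Let specnorm_le_rho x : dot x x = 1 -> specnorm (hess L x) <= rho L.
Proof.
move=> x1; apply: ub_le_sup; last by exists x => //; exact: norm2_eq1.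
(* An unbounded set of spectral norms would have supremum [0]. *)
apply: contrapT => nub; move: rho_gt0; rewrite /rho sup_out ?ltxx //.
by case.
Qed.

Lemma hess_quad_le x v : x != 0 ->
  `|dot (v *m hess L x) v| <= rho L * dot v v / dot x x.
Proof.
move=> x0; have n0 := norm2_gt0 x0.
have x_gt0 : 0 < dot x x by rewrite dot_gt0.
rewrite -(@hess_quad_scale (norm2 x)^-1) ?invr_gt0 // normrM.
rewrite exprVn norm2_sqr ger0_norm ?invr_ge0 ?dot_ge0 // mulrC.
rewrite ler_pM2r ?invr_gt0 //.
apply: le_trans (quadratic_form_le_specnorm _ _) _.
by rewrite ler_wpM2r ?dot_ge0 // specnorm_le_rho // dot_normalize.
Qed.

(* Along the line [x + s g], with [g] the gradient at [x], the slope drops at rate at most [rho / (1 + s^2)] and tends to [0] at infinity. *)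
Let grad_unit_le x : dot x x = 1 -> norm2 (grad L x) <= pi * rho L / 2.
Proof.
move=> x1; have x0 : x != 0 by rewrite -dot_gt0 x1.
have p0 : 0 < pi :> R by exact: pi_gt0.
have [->|g0] := eqVneq (grad L x) 0.
  rewrite /norm2 big1 => [|i _]; last by rewrite mxE expr0n.
  by rewrite sqrtr0 divr_ge0 // mulr_ge0 // ltW.
set v := normalize (grad L x).
have v1 : dot v v = 1 by exact: dot_normalize.
have v0 : v != 0 by rewrite -dot_gt0 v1.
have n0 := norm2_gt0 g0.
have gv : dot (grad L x) v = norm2 (grad L x).
  by rewrite /v /normalize dotZr -norm2_sqr expr2 mulKf // gt_eqF.
have xv : dot x v = 0.
  by rewrite /v /normalize dotZr dotC grad_perp ?mulr0.
have vx : dot v x = 0 by rewrite dotC.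
clearbody v.
have line s : dot (x + s *: v) (x + s *: v) = 1 + s ^+ 2.
  by rewrite !dotE xv vx x1 v1; ring.
have [phi phiE] : exists phi : R -> R,
    phi = fun s => dot (grad L (x + s *: v)) v by eexists.
(* Since [|x + s v|^2 = 1 + s^2], the comparison function is [rho L * atan s], and its limit at
   infinity is the source of the constant [pi / 2]. *)
have slope (s : R) : 0 <= s -> phi 0 <= phi s + rho L * (pi / 2).
  move=> s0; apply: (@le_trans _ _ (phi s + rho L * atan s)); last first.
    by rewrite lerD2l ler_pM2l // ltW // atan_ltpi2.
  pose f h := - (phi h + rho L * atan h).
  suff : f s <= f 0 by rewrite /f lerN2 atan0; lra.
  pose df h := - (dot (v *m hess L (x + h *: v)) v + rho L * (1 + h ^+ 2)^-1).
  apply: (@le_of_derive_le0 _ f df) => //.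
    move=> h _; apply: is_deriveN; apply: is_deriveD.
    rewrite phiE; apply: dergrad; exact: perp_line_neq0.
  move=> h _; rewrite /df oppr_le0.
  have := hess_quad_le v (perp_line_neq0 h x0 xv).
  by rewrite line v1 mulr1 ler_norml => /andP[+ _]; lra.
have -> : norm2 (grad L x) = phi 0 by rewrite phiE scale0r addr0.
rewrite leNgt; apply/negP => lt.
pose e := phi 0 - pi * rho L / 2.
have e0 : 0 < e by rewrite subr_gt0.
(* With [h = s^-1] and the gradient homogeneous of degree -1, the slope at infinity becomes a
   function of [h] continuous at [0] and vanishing there. *)
pose psi (h : R) := h * dot (grad L (v + h *: x)) v.
have phi_psi (h : R) : 0 < h -> phi h^-1 = psi h.
  move=> h0; have hv0 := perp_line_neq0 h v0 vx.
  rewrite phiE; have -> : x + h^-1 *: v = h^-1 *: (v + h *: x).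
    by rewrite scalerDr scalerA mulVf ?gt_eqF // scale1r addrC.
  have -> := grad_scale (c := h^-1) _ hv0; first by rewrite invrK dotZl.
  by rewrite invr_gt0.
have psi_cvg : psi @ (0 : R) --> (0 : R).
  have -> : (0 : R) = 0 * dot (grad L (v + 0 *: x)) v by rewrite mul0r.
  apply: cvgM; first by rewrite mul0r; exact: cvg_id.
  have : v + 0 *: x != 0 by rewrite scale0r addr0.
  move=> /(dergrad v) [+ _] => /derivable1_diffP /differentiable_continuous.
  by rewrite mul0r.
have psi_right : psi @ (0 : R)^'+ --> (0 : R) by exact: cvg_at_right_filter.
have : \forall h \near (0 : R)^'+, False.
  near=> h.
  have h0 : 0 < h by [].
  have := slope h^-1; rewrite invr_ge0 ltW // phi_psi // => /(_ isT).
  suff : psi h < e by rewrite /e; lra.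
  near: h; apply: (psi_right [set y | y < e]).
  by apply: lt_nbhsl.
by move=> /filter_ex [].
Unshelve. all: by end_near. Qed.

Lemma grad_normalize x : x != 0 ->
  norm2 (grad L (normalize x)) ^+ 2 = dot x x * dot (grad L x) (grad L x).
Proof.
move=> x0; have n0 := norm2_gt0 x0.
rewrite norm2_sqr grad_scale ?invr_gt0 // dotZl dotZr invrK mulrA -expr2.
by rewrite (norm2_sqr x).
Qed.

Lemma grad_normalize_le x : x != 0 ->
  norm2 (grad L (normalize x)) ^+ 2 <= (pi * rho L / 2) ^+ 2.
Proof.
move=> x0; have g := grad_unit_le (dot_normalize x0).
by rewrite lerXn2r // nnegrE ?norm2_ge0 // (le_trans (norm2_ge0 _) g).
Qed.

(* A chord spanning at most a right angle stays at distance at least [1 / sqrt 2] from the origin. *)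
Let acute_diff_le p q : dot p p = 1 -> dot q q = 1 -> 0 <= dot p q ->
  L p - L q <= pi * rho L.
Proof.
move=> p1 q1 pq0; set v := q - p.
have vv : dot v v = 2 - 2 * dot p q by rewrite /v !dotE p1 q1 (dotC q); ring.
have line s : dot (p + s *: v) (p + s *: v) =
    (1 - s) ^+ 2 + 2 * (s * (1 - s)) * dot p q + s ^+ 2.
  by rewrite /v !dotE p1 q1 (dotC q); ring.
have line_ge s : 0 <= s <= 1 -> 1 / 2 <= dot (p + s *: v) (p + s *: v).
  move=> /andP[s0 s1]; rewrite line.
  have : 0 <= s * (1 - s) * dot p q by rewrite !mulr_ge0 // subr_ge0.
  have := sqr_ge0 (s - 1 / 2); nra.
have line0 s : 0 <= s <= 1 -> p + s *: v != 0.
  by move=> /line_ge; rewrite -dot_gt0; apply: lt_le_trans; lra.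
have p0 : 0 <= pi * rho L by rewrite mulr_ge0 ?pi_ge0 // ltW.
pose f s := - L (p + s *: v) - pi * rho L * s.
suff : f 1 <= f 0.
  rewrite /f scale1r scale0r addr0 /v [p + _]addrC subrK; lra.
pose df s := - dot (grad L (p + s *: v)) v - pi * rho L.
apply: (@le_of_derive_le0 _ f df) => // s s01.
  have H : is_derive s 1 (fun h : R => pi * rho L *: h) (pi * rho L *: 1).
    exact: is_deriveZ.
  by move: H; rewrite /df [X in is_derive _ _ _ X]mulr1 => H;
     apply: is_deriveB; apply: is_deriveN; apply: derL; exact: line0.
rewrite /df; set y := p + s *: v.
have yy := line_ge s s01; rewrite -/y in yy.
have := CauchySchwarz_dot (grad L y) v.
have := grad_normalize_le (line0 s s01); rewrite grad_normalize ?line0 //.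
rewrite -/y.
have gg := dot_ge0 (grad L y).
set g := dot (grad L y) (grad L y) in gg *; set D := dot (grad L y) v.
move=> G DD.
(* Both [g <= 2 (pi rho / 2)^2], from [dot y y >= 1 / 2], and [dot v v <= 2] lose a factor 2;
   together they give exactly [(pi rho)^2]. *)
have : D ^+ 2 <= (pi * rho L) ^+ 2.
  apply: (le_trans DD); rewrite vv.
  have : g * (2 - 2 * dot p q) <= g * 2 by rewrite ler_wpM2l //; lra.
  have : 1 / 2 * g <= dot y y * g by rewrite ler_wpM2r.
  have -> : (pi * rho L) ^+ 2 = 4 * (pi * rho L / 2) ^+ 2 by field.
  lra.
rewrite -ler_sqrt ?sqr_ge0 // !sqrtr_sqr (ger0_norm p0) ler_norml.
by move=> /andP[+ _]; lra.
Qed.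

Let L_normalize x : x != 0 -> L (normalize x) = L x.
Proof. by move=> x0; rewrite LS // invr_gt0 norm2_gt0. Qed.

(* The unit gradient at [x] or its opposite is a midpoint of two acute chords from [x] to [y]. *)
Lemma oscillation_le x y : x != 0 -> y != 0 -> grad L x != 0 ->
  L x - L y <= 2 * pi * rho L.
Proof.
move=> x0 y0 g0; rewrite -(L_normalize x0) -(L_normalize y0).
have [w w1 [xw yw]] : exists2 w, dot w w = 1 &
    0 <= dot (normalize x) w /\ 0 <= dot w (normalize y).
  have gx : dot (normalize x) (normalize (grad L x)) = 0.
    by rewrite !dotE (dotC x) grad_perp // !mulr0.
  have g1 := dot_normalize g0.
  have [ge|lt] := leP 0 (dot (normalize (grad L x)) (normalize y)).
    by exists (normalize (grad L x)) => //; rewrite gx.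
  exists (- normalize (grad L x)); first by rewrite dotNl dotNr opprK.
  by rewrite dotNr dotNl gx oppr0 lexx oppr_ge0 ltW.
have := acute_diff_le (dot_normalize x0) w1 xw.
have := acute_diff_le w1 (dot_normalize y0) yw.
lra.
Qed.

(** The gradient is orthogonal to [x], so the step only moves away from the origin and the Hessian
    bound at [x] holds on the whole segment. Two integrations of that bound give the second-order
    estimate. *)
Lemma descent x (c : R) : x != 0 -> 0 <= c ->
  L (x - c *: grad L x) <=
  L x - c * (1 - rho L * c / (2 * dot x x)) * dot (grad L x) (grad L x).
Proof.
move=> x0 c0; have := grad_perp x0.
have [g gE] : exists g, g = grad L x by eexists.
rewrite -gE dotC => xg'.
have xg : dot x (- g) = 0 by rewrite dotNr xg' oppr0.
have [G GE] : exists G, G = dot g g by eexists.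
rewrite -GE.
have line0 s := perp_line_neq0 s x0 xg.
have x_gt0 : 0 < dot x x by rewrite dot_gt0.
have [B BE] : exists B, B = rho L * G / dot x x by eexists.
have line s : dot x x <= dot (x + s *: - g) (x + s *: - g).
  rewrite [leRHS]dotDl !dotDr [dot (s *: _) x]dotC dotZr xg mulr0 addr0 add0r.
  by rewrite lerDl dot_ge0.
have G0 : 0 <= G by rewrite GE dot_ge0.
have slope s : 0 <= s -> dot (grad L (x + s *: - g)) (- g) <= - G + B * s.
  move=> s0.
  pose f h := dot (grad L (x + h *: - g)) (- g) - B * h.
  suff : f s <= f 0.
    have -> : f 0 = - G by rewrite /f scale0r addr0 -gE dotNr -GE mulr0 subr0.
    by rewrite /f; lra.
  pose df h := dot (- g *m hess L (x + h *: - g)) (- g) - B.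
  apply: (@le_of_derive_le0 _ f df) => // h _.
    have : is_derive h 1 (fun h : R => B *: h) (B *: 1) by exact: is_deriveZ.
    rewrite [X in is_derive _ _ _ X]mulr1 => H.
    by apply: is_deriveB; exact: dergrad.
  rewrite /df subr_le0.
  have := hess_quad_le (- g) (line0 h); rewrite ler_norml => /andP[_].
  move=> /le_trans; apply; rewrite dotNl dotNr opprK -GE BE.
  rewrite ler_wpM2l ?mulr_ge0 // ?(ltW rho_gt0) //.
  by rewrite lef_pV2 // posrE (lt_le_trans x_gt0).
pose f h := L (x + h *: - g) + G * h - B / 2 * h ^+ 2.
suff : f c <= f 0.
  rewrite /f scale0r addr0 expr0n !mulr0 addr0 subr0 scalerN.
  have -> : c * (1 - rho L * c / (2 * dot x x)) * G = G * c - B / 2 * c ^+ 2.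
    by rewrite BE; field; rewrite gt_eqF.
  lra.
pose df h := dot (grad L (x + h *: - g)) (- g) + G - B / 2 * (2 * h).
apply: (@le_of_derive_le0 _ f df) => // h h0c.
  have H1 : is_derive h 1 (fun h : R => G *: h) (G *: 1) by exact: is_deriveZ.
  have H2 : is_derive h 1 (fun h : R => B / 2 *: h ^+ 2) (B / 2 *: (2 * h)).
    apply: is_deriveZ; apply: is_derive_eq.
    by rewrite /GRing.scale /=; ring.
  move: H1; rewrite [X in is_derive _ _ _ X]mulr1 => H1.
  exact: (is_deriveB (is_deriveD (derL (line0 h)) H1) H2).
by rewrite /df; have /andP[h0 _] := h0c; have := slope h h0; lra.
Qed.

End ScaleInvariant.

(** * The scalar recursion for squared norm and loss, refuted when [G] stays above the threshold *)

Section SquaredNormRecursion.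
Context {R : realType} (eta u r K : R) (T : nat) (n l G : nat -> R).
Let a : R := r * pi ^+ 2 * eta.
Let eps : R := 8 * pi ^+ 4 * r ^+ 2 * u.
(** Effective step size: an iterate is [1 - u] times a plain gradient step of size [c], and [L]
    ignores the factor. *)
Let c : R := eta / (1 - u).

Hypothesis eta_gt0 : 0 < eta.
Hypothesis u_gt0 : 0 < u.
Hypothesis r_gt0 : 0 < r.
Hypothesis n_gt0 : forall t, 0 < n t.
Hypothesis n_step : forall t, n t.+1 = (1 - u) ^+ 2 * n t + eta ^+ 2 * G t / n t.
Hypothesis l_step : forall t,
  l t.+1 <= l t - c * (1 - r * c / (2 * n t)) * (G t / n t).
Hypothesis G_le : forall t, G t <= (pi * r / 2) ^+ 2.
Hypothesis l_range : forall s t, 0 < G s -> l s - l t <= 2 * pi * r.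
Hypothesis n0E : n 0%N = expR K * a \/ n 0%N = expR (- K) * a.
Hypothesis K_ge0 : 0 <= K.
(** The time budget: [K + 1] covers growth, overshoot and decay, and the remaining [2] leaves
    [1 / u] steps for the final descent. *)
Hypothesis T_ge : K + 3 <= 2 * u * T%:R.
Hypothesis G_gt : forall t, (t <= T)%N -> eps < G t.

Let pi2 : 2 <= pi :> R. Proof. exact: pi_ge2. Qed.

Let a_gt0 : 0 < a.
Proof. by rewrite /a !mulr_gt0 ?exprn_gt0 ?pi_gt0. Qed.

Let eps_gt0 : 0 < eps.
Proof. by rewrite /eps !mulr_gt0 ?exprn_gt0 ?pi_gt0. Qed.

(** The threshold lies below the a priori bound on [G], which it equals up to the factor
    [32 pi^2 u]; and [pi >= 2]. *)
Lemma step_size_small : 128 * u < 1.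
Proof.
have := lt_le_trans (G_gt (leq0n T)) (G_le 0%N).
have -> : eps = 32 * pi ^+ 2 * u * (pi * r / 2) ^+ 2 by rewrite /eps; field.
rewrite gtr_pMl; last by rewrite exprn_gt0 // !mulr_gt0 ?pi_gt0 // invr_gt0.
by apply: le_lt_trans; rewrite ler_pM2r //; move: pi2; nra.
Qed.

Let u_small := step_size_small.

Let contract_le : (1 - u) ^+ 2 <= expR (- (2 * u)).
Proof.
have -> : - (2 * u) = - u + - u by ring.
rewrite expRD -expr2 lerXn2r ?nnegrE ?expR_ge0 //; first by move: u_small; lra.
exact: expR_ge1Dx.
Qed.

Let growth_ge : expR (2 * u) <= 1 + 6 * u.
Proof.
have := expR_ge1Dx (- (2 * u)); rewrite expRN.
have := u_small; have := expR_gt0 (2 * u); set e := expR _ => e0 us h.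
have : e * (1 - 2 * u) <= 1.
  by have := ler_wpM2l (ltW e0) h; rewrite divff ?gt_eqF.
have u2 : 0 < 1 - 2 * u by lra.
by move=> /le_trans h1; rewrite -(ler_pM2r u2); apply: h1; move: u_gt0; nra.
Qed.

(** The threshold satisfies [eta^2 eps = 8 u a^2]. Below [a] the gradient thus adds at least
    [8 u n], of which weight decay takes back at most [2 u n]. *)
Let small_norm_grows t : (t <= T)%N -> n t <= a -> (1 + 6 * u) * n t <= n t.+1.
Proof.
move=> tT na; rewrite n_step.
have nt := n_gt0 t; have u0 := u_gt0.
have : eta ^+ 2 * eps <= eta ^+ 2 * G t.
  by rewrite ler_pM2l ?exprn_gt0 // ltW // G_gt.
have -> : eta ^+ 2 * eps = 8 * u * a ^+ 2 by rewrite /eps /a; ring.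
move=> h.
have : 8 * u * n t <= eta ^+ 2 * G t / n t.
  rewrite ler_pdivlMr //; apply: le_trans h.
  rewrite -!mulrA ler_pM2l // ler_pM2l // -expr2.
  by rewrite lerXn2r // nnegrE ltW.
nra.
Qed.

(* Overshooting [a] by a factor [k] requires [n t] to be of order [a / k], and the growth steps thus saved pay for the extra decay steps. *)
Let overshoot t : n t <= a -> n t * n t.+1 <= 2 * a ^+ 2.
Proof.
move=> na; have nt := n_gt0 t.
have -> : n t * n t.+1 = (1 - u) ^+ 2 * n t ^+ 2 + eta ^+ 2 * G t.
  by rewrite n_step; field; rewrite gt_eqF.
have : eta ^+ 2 * G t <= a ^+ 2.
  apply: (@le_trans _ _ (eta ^+ 2 * (pi * r / 2) ^+ 2)).
    by rewrite ler_pM2l ?exprn_gt0.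
  have -> : a ^+ 2 = eta ^+ 2 * (pi * r / 2) ^+ 2 * (4 * pi ^+ 2).
    by rewrite /a; field.
  apply: ler_peMr; first by rewrite mulr_ge0 ?sqr_ge0.
  by move: pi2; nra.
have : n t ^+ 2 <= a ^+ 2 by rewrite lerXn2r // nnegrE ltW.
have : (1 - u) ^+ 2 <= 1.
  by apply: exprn_ile1; move: u_gt0 u_small; lra.
have : 0 <= n t ^+ 2 by rewrite sqr_ge0.
nra.
Qed.

(** The norm has reached [a] and lies under the decaying envelope [e^(K + 1 - 2 u t) a]; the [1] in
    the exponent pays for the overshoot. *)
Let large t := a <= n t /\ expR (2 * u * t%:R) * n t <= expR (K + 1) * a.

Let expRS t : expR (2 * u * t.+1%:R) = expR (2 * u) * expR (2 * u * t%:R).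
Proof. by rewrite -expRD -natr1; congr expR; ring. Qed.

Let large_or_growing t : (t <= T)%N ->
  (exists2 s, (s <= t)%N & large s) \/
  n t < a /\ expR (2 * u * t%:R) * (expR (- K) * a) <= n t.
Proof.
have u0 := u_gt0; have us := u_small; have K0 := K_ge0;
have T3 := T_ge; elim: t => [|t IH] tT.
  rewrite mulr0 expR0 mul1r.
  have [an|na] := leP a (n 0%N).
    left; exists 0%N => //; split=> //.
    rewrite mulr0 expR0 mul1r.
    have : expR (- K) * a <= expR K * a by rewrite ler_pM2r // ler_expR; lra.
    have : expR K * a <= expR (K + 1) * a by rewrite ler_pM2r // ler_expR; lra.
    by case: n0E => ->; lra.
  right; split=> //; case: n0E => -> //.
  by rewrite ler_pM2r // ler_expR; lra.
have [[s st ls]|[na nt]] := IH (ltnW tT).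
  by left; exists s => //; exact: leqW.
have grow := small_norm_grows (ltnW tT) (ltW na).
have E0 := expR_gt0 (2 * u * t%:R).
have [an|na'] := leP a (n t.+1); last first.
  right; split=> //; rewrite expRS -mulrA.
  apply: le_trans grow.
  apply: ler_pM => //.
  by rewrite mulr_ge0 ?expR_ge0 // mulr_ge0 ?expR_ge0 // ltW.
left; exists t.+1 => //; split => //.
(* At the crossing step, multiplying by [n t] lets [overshoot] bound the product [n t * n t.+1],
   while past growth bounds [e^(2 u t) a] by [e^K n t]. *)
rewrite -(ler_pM2l (n_gt0 t)) expRS.
have ov := overshoot (ltW na).
have e2 := growth_ge.
have EK : expR (2 * u * t%:R) * a <= expR K * n t.
  move: nt; rewrite -(ler_pM2l (expR_gt0 K)); apply: le_trans.
  by rewrite !mulrA (mulrAC (expR K)) -expRD subrr expR0 mul1r.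
rewrite expRD.
(* The overshoot factor [2] times [e^(2u) <= 17 / 16] must be absorbed by one factor [e]. *)
have e1 : 17 / 8 <= expR 1 :> R.
  have := expR_ge1Dx (1 / 8 : R).
  have -> : expR 1 = expR (1 / 8) ^+ 8 :> R.
    by rewrite -expRM_natl; congr expR; field.
  set z := expR _ => hz.
  have : 9 / 8 <= z by lra.
  move=> {}hz; apply: (@le_trans _ _ ((9 / 8) ^+ 8)); first lra.
  by rewrite lerXn2r ?nnegrE //; lra.
apply: (@le_trans _ _ (17 / 16 * expR (2 * u * t%:R) * (2 * a ^+ 2))).
  have -> : n t * (expR (2 * u) * expR (2 * u * t%:R) * n t.+1) =
     (expR (2 * u) * expR (2 * u * t%:R)) * (n t * n t.+1) by ring.
  have nn : 0 <= n t * n t.+1 by rewrite mulr_ge0 // ltW.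
  apply: ler_pM => //.
  by rewrite ler_pM2r //; lra.
have -> : 17 / 16 * expR (2 * u * t%:R) * (2 * a ^+ 2) =
  (expR (2 * u * t%:R) * a) * (17 / 8 * a) by field.
have -> : n t * (expR K * expR 1 * a) = (expR K * n t) * (expR 1 * a) by ring.
have a0 := ltW a_gt0; apply: ler_pM; rewrite ?EK ?ler_pM2r //.
- by apply: mulr_ge0 => //; exact: expR_ge0.
- by apply: mulr_ge0 => //; lra.
Qed.

Let large_norm_reached : exists2 s, (s <= T)%N & large s.
Proof.
have [//|[na]] := large_or_growing (leqnn T).
have T3 := T_ge; rewrite mulrA -expRD => h; have := le_lt_trans h na.
have : a <= expR (2 * u * T%:R - K) * a.
  rewrite ler_peMl ?(ltW a_gt0) //.
  by apply: (le_trans _ (expR_ge1Dx _)); lra.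
by move=> /le_lt_trans /[apply]; rewrite ltxx.
Qed.

(** At such norms [pi^2 >= 4] keeps the curvature correction below [1 / 4], so over half of the
    first-order decrease survives. The factor [(1 - u)^2] allows for one contraction from just above
    [a]. *)
Let descent t : (t <= T)%N -> (1 - u) ^+ 2 * a <= n t ->
  eta * (G t / n t) <= 2 * (l t - l t.+1).
Proof.
move=> tT nt_ge; have nt := n_gt0 t; have u0 := u_gt0; have us := u_small.
have Gt : 0 < G t / n t by rewrite divr_gt0 // (lt_trans eps_gt0) // G_gt.
have re0 : 0 < r * eta by rewrite mulr_gt0.
have u1 : 0 < 1 - u by lra.
have p4 : 4 <= pi ^+ 2 :> R by move: pi2; nra.
have rn : 2 * (r * eta) <= (1 - u) * n t.
  have aE : a = r * eta * pi ^+ 2 by rewrite /a; ring.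
  have a4 : r * eta * 4 <= a by rewrite aE ler_pM2l.
  have h1 : (1 - u) * ((1 - u) ^+ 2 * a) <= (1 - u) * n t by rewrite ler_pM2l.
  have h2 : 1 / 2 <= (1 - u) * (1 - u) ^+ 2.
    rewrite -exprS; apply: (@le_trans _ _ ((4 / 5) ^+ 3)); first lra.
    by rewrite lerXn2r ?nnegrE //; lra.
  apply: le_trans h1; rewrite [leRHS]mulrA.
  apply: (@le_trans _ _ (1 / 2 * (r * eta * 4))); first lra.
  by apply: ler_pM => //; lra.
have c_ge : eta <= c by rewrite /c ler_pdivlMr // ler_piMr ?(ltW eta_gt0) //; lra.
have q_le : r * c / (2 * n t) <= 1 / 4.
  have -> : r * c / (2 * n t) = (r * eta) / ((1 - u) * n t) / 2.
    by rewrite /c; field; rewrite !gt_eqF.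
  rewrite ler_pdivrMr // ler_pdivrMr ?mulr_gt0 //; lra.
have half : eta / 2 <= c * (1 - r * c / (2 * n t)).
  apply: (@le_trans _ _ (eta * (3 / 4))); first by move: eta_gt0; lra.
  by have e0 := eta_gt0; apply: ler_pM => //; lra.
have := l_step t; have := ler_pM2r Gt (eta / 2) (c * (1 - r * c / (2 * n t))).
rewrite half; lra.
Qed.

(** Bound on the norm once the envelope is below [a]: the rest is [2 * eta] times the oscillation
    [2 pi r]. *)
Let b : R := a + 4 * pi * r * eta.

(** The gain [eta^2 G / n] is at most [2 eta] times the decrease of [l], which gives the decay
    estimate. With [M = (K + 1) / (2 u)], each step starting after [M] has [n <= b] and lowers [l]
    by at least [eta eps / (2 b)]; at least [t - 1 - M] of them precede time [t]. *)
Let decay s j (D := l s - l (s + j)%N) :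
  large s -> (s <= T)%N -> (s + j <= T.+1)%N ->
  [/\ (1 - u) ^+ 2 * a <= n (s + j)%N,
      0 <= D,
      expR (2 * u * (s + j)%:R) * n (s + j)%N <=
        expR (K + 1) * a + expR (2 * u * (s + j)%:R) * (2 * eta * D) &
      eta * eps * ((s + j)%:R - 1 - (K + 1) / (2 * u)) <= b * (2 * D)].
Proof.
move=> [an En] sT; rewrite {}/D.
have u0 := u_gt0; have us := u_small; have e0 := eta_gt0.
have ee0 : 0 < eta * eps by rewrite mulr_gt0.
have p0 : 0 < pi :> R by exact: pi_gt0.
have b0 : 0 < b.
  by rewrite /b addr_gt0 // !mulr_gt0.
have contract1 : (1 - u) ^+ 2 <= 1 by apply: exprn_ile1; lra.
elim: j => [|j IH].
  rewrite addn0 subrr !mulr0 addr0 => _; split=> //.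
    by apply: le_trans an; rewrite ler_piMl // ltW.
  (* Here [a <= n s] and the envelope force [s <= (K + 1) / (2 u)], so the initial count is
     negative. *)
  rewrite pmulr_rle0 //.
  have : expR (2 * u * s%:R) <= expR (K + 1).
    rewrite -(ler_pM2r a_gt0); apply: le_trans En.
    by rewrite ler_pM2l // expR_gt0.
  rewrite ler_expR => h.
  have : s%:R <= (K + 1) / (2 * u) by rewrite ler_pdivlMr ?mulr_gt0 //; lra.
  lra.
rewrite addnS ltnS => tT; have [] := IH (leqW tT).
set t := (s + j)%N in tT * => nt_ge D0 En_t lin.
have dl := descent tT nt_ge.
have nt := n_gt0 t.
have Gt : 0 < G t by rewrite (lt_trans eps_gt0) // G_gt.
have Gn : 0 < G t / n t by rewrite divr_gt0.
have eGn : 0 < eta * (G t / n t) by rewrite mulr_gt0.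
have D1 : 0 <= l s - l t.+1 by lra.
have dE : 2 * eta * (l s - l t) + eta ^+ 2 * G t / n t
          <= 2 * eta * (l s - l t.+1).
  have -> : eta ^+ 2 * G t / n t = eta * (eta * (G t / n t)) by ring.
  have := ler_pM2l eta_gt0 (eta * (G t / n t)) (2 * (l t - l t.+1)).
  by rewrite dl; lra.
split=> //.
- have [na|na] := leP (n t) a.
    apply: le_trans (small_norm_grows tT na).
    by apply: (le_trans nt_ge); rewrite ler_peMl ?(ltW nt) //; lra.
  rewrite n_step; apply: (@le_trans _ _ ((1 - u) ^+ 2 * n t)).
    by rewrite ler_wpM2l ?sqr_ge0 // ltW.
  by rewrite lerDl -mulrA mulr_ge0 ?sqr_ge0 ?(ltW Gn).
- have E0 := expR_gt0 (2 * u * t%:R).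
  have E1 := expR_gt0 (2 * u).
  rewrite n_step mulrDr.
  have h1 : expR (2 * u * t.+1%:R) * ((1 - u) ^+ 2 * n t)
            <= expR (2 * u * t%:R) * n t.
    rewrite mulrA ler_pM2r // expRS mulrAC ler_piMl ?(ltW E0) //.
    apply: (@le_trans _ _ (expR (2 * u) * expR (- (2 * u)))).
      by rewrite ler_pM2l.
    by rewrite -expRD subrr expR0.
  have h2 : expR (2 * u * t%:R) * (2 * eta * (l s - l t)) <=
            expR (2 * u * t.+1%:R) * (2 * eta * (l s - l t)).
    by rewrite ler_wpM2r ?mulr_ge0 ?(ltW e0) // ler_expR ler_pM2l ?mulr_gt0 ?ler_nat.
  have := ler_pM2l (expR_gt0 (2 * u * t.+1%:R))
    (2 * eta * (l s - l t) + eta ^+ 2 * G t / n t) (2 * eta * (l s - l t.+1)).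
  by rewrite dE mulrDr; lra.
have [tM|tM] := leP t%:R ((K + 1) / (2 * u)).
  apply: (@le_trans _ _ 0); last by rewrite !mulr_ge0 // ltW.
  by rewrite pmulr_rle0 // -natr1; lra.
have nb : n t <= b.
  have E0 := expR_gt0 (2 * u * t%:R).
  have EK : expR (K + 1) <= expR (2 * u * t%:R).
    by rewrite ler_expR; move: tM; rewrite ltr_pdivrMr ?mulr_gt0 //; lra.
  rewrite -(ler_pM2l E0) (le_trans En_t) // [leRHS]mulrDr.
  apply: lerD; first by rewrite ler_pM2r.
  rewrite ler_pM2l //.
  have lst := l_range t (lt_trans eps_gt0 (G_gt sT)).
  by have := ler_pM2l eta_gt0 (l s - l t) (2 * pi * r); rewrite lst; lra.
have step : eta * eps <= b * (2 * (l t - l t.+1)).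
  apply: (@le_trans _ _ (b * (eta * (G t / n t)))); last by rewrite ler_pM2l.
  have -> : b * (eta * (G t / n t)) = eta * (G t * (b / n t)) by ring.
  rewrite ler_pM2l // (le_trans (ltW (G_gt tT))) // ler_peMr ?(ltW Gt) //.
  by rewrite ler_pdivlMr // mul1r.
rewrite -natr1; lra.
Qed.

Lemma squared_norm_recursion_contradiction : False.
Proof.
have [s sT ls] := large_norm_reached.
(* The step from [T] still descends, so the count runs to [T.+1], which cancels its [-1]. *)
have [] := @decay s (T.+1 - s) ls sT; rewrite subnKC // ?leqW //.
move=> _ D0 _; have u0 := u_gt0; have r0 := r_gt0; have e0 := eta_gt0.
have p0 : 0 < pi :> R by exact: pi_gt0.
have Dle : l s - l T.+1 <= 2 * pi * r.
  exact/l_range/(lt_trans eps_gt0)/G_gt.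
have b0 : 0 < b by rewrite /b addr_gt0 // !mulr_gt0.
have count : u^-1 <= T.+1%:R - 1 - (K + 1) / (2 * u).
  have -> : u^-1 = (K + 3) / (2 * u) - (K + 1) / (2 * u).
    by field; rewrite gt_eqF.
  have -> : T.+1%:R - 1 = T%:R :> R by rewrite -[T.+1]addn1 natrD addrK.
  rewrite lerD2r ler_pdivrMr ?mulr_gt0 //.
  by have := T_ge; lra.
have ee0 : 0 < eta * eps by rewrite mulr_gt0.
have h1 : eta * eps * u^-1 <= eta * eps * (T.+1%:R - 1 - (K + 1) / (2 * u)).
  by rewrite ler_pM2l.
have h2 : b * (2 * (l s - l T.+1)) <= b * (4 * pi * r).
  by rewrite ler_pM2l //; lra.
move=> /(le_trans h1) /le_trans /(_ h2).
(* After removing the common factor, the inequality reads [2 pi^2 <= pi + 4], which fails for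
   [pi >= 2]. *)
have -> : eta * eps * u^-1 = (4 * r ^+ 2 * eta * pi ^+ 2) * (2 * pi ^+ 2).
  by rewrite /eps; field; rewrite gt_eqF.
have -> : b * (4 * pi * r) = (4 * r ^+ 2 * eta * pi ^+ 2) * (pi + 4).
  by rewrite /b /a; ring.
rewrite ler_pM2l; last by rewrite !mulr_gt0.
by move: pi2; nra.
Qed.

End SquaredNormRecursion.

(** * Reduction of the iterates to the scalar recursion *)

Theorem mainTheorem1 (R : realType) (d : nat) (L : 'rV[R]_d -> R)
  (eta lam : R) (x : nat -> 'rV[R]_d) :
  C2_off0 L -> scale_invariant L -> 0 < rho L ->
  0 < eta -> 0 < lam -> eta * lam <= 1 / 2 ->
  x 0%N != 0 ->
  (forall t : nat, x t.+1 = (1 - eta * lam) *: x t - eta *: grad L (x t)) ->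
  exists t : nat, (t <= T0 (rho L) eta lam (norm2 (x 0%N)))%N /\
    norm2 (grad L (normalize (x t))) ^+ 2
      <= 8 * pi ^+ 4 * rho L ^+ 2 * lam * eta.
Proof.
move=> LC2 LS rho0 eta0 lam0 el x00 xS.
set T := T0 _ _ _ _.
have [u uE] : exists u, u = eta * lam by eexists.
have u0 : 0 < u by rewrite uE mulr_gt0.
rewrite -uE in el.
have u1 : 0 < 1 - u by lra.
have sq_step t : x t != 0 -> dot (x t.+1) (x t.+1) =
    (1 - u) ^+ 2 * dot (x t) (x t) +
    eta ^+ 2 * dot (grad L (x t)) (grad L (x t)).
  move=> xt; rewrite xS -uE.
  have := grad_perp LC2 LS xt; move: (grad L (x t)) => g gx.
  by rewrite !dotE (dotC (x t) g) gx; ring.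
have x0 t : x t != 0.
  elim: t => // t xt; rewrite -dot_gt0 sq_step // ltr_pwDl //.
    by rewrite mulr_gt0 ?exprn_gt0 // dot_gt0.
  by rewrite mulr_ge0 ?sqr_ge0 // dot_ge0.
have [n nE] : exists n, n = fun t => dot (x t) (x t) by eexists.
have [G GE] : exists G, G = fun t => norm2 (grad L (normalize (x t))) ^+ 2.
  by eexists.
have n0 t : 0 < n t by rewrite nE dot_gt0.
have GnE t : G t / n t = dot (grad L (x t)) (grad L (x t)).
  by rewrite GE grad_normalize // nE mulrAC divff ?mul1r // dot_eq0.
pose a := rho L * pi ^+ 2 * eta.
have a0 : 0 < a by rewrite !mulr_gt0 // pi_gt0.
have na0 : 0 < n 0%N / a by rewrite divr_gt0.
pose K := `|ln (n 0%N / a)|.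
apply: contrapT => none.
apply: (@squared_norm_recursion_contradiction R eta u (rho L) K T n
  (fun t => L (x t)) G) => //.
- move=> t; rewrite -mulrA GnE nE sq_step //.
- move=> t; rewrite GnE nE.
  have c0 : 0 <= eta / (1 - u) by rewrite divr_ge0 ?ltW.
  have := descent LC2 LS rho0 (x0 t) c0; congr (_ <= _).
  (* Weight decay is factored out as a scaling, invisible to [L], so that [descent] applies to a
     pure gradient step. *)
  have -> : x t.+1 = (1 - u) *: (x t - (eta / (1 - u)) *: grad L (x t)).
    rewrite xS -uE scalerBr scalerA; congr (_ - _ *: _).
    by field; rewrite gt_eqF.
  rewrite LS //.
  have xg : dot (x t) (grad L (x t)) = 0 by rewrite dotC grad_perp.
  by rewrite -scaleNr perp_line_neq0.
- by move=> t; rewrite GE; exact: grad_normalize_le.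
- move=> s t Gs; apply: oscillation_le => //.
  by rewrite -dot_gt0 -GnE divr_gt0.
- have nK : n 0%N = expR (ln (n 0%N / a)) * a.
    by rewrite lnK ?posrE // divfK // gt_eqF.
  have [ge|lt] := leP 0 (ln (n 0%N / a)).
    by left; rewrite /K ger0_norm.
  by right; rewrite /K ltr0_norm // opprK.
- exact: normr_ge0.
- have -> : K + 3 = 2 * u * ((2 * eta * lam)^-1 * (K + 3)).
    by rewrite uE; field; rewrite !gt_eqF.
  rewrite ler_pM2l ?mulr_gt0 //.
  rewrite /T /T0 norm2_sqr -/a natr_absz nE in K *.
  by apply: (le_trans (ceil_ge _)); rewrite ler_int ler_norm.
- move=> t tT; rewrite ltNge; apply/negP => le; apply: none; exists t; split=> //.
  by move: le; rewrite GE uE; congr (_ <= _); ring.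
Qed.
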